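(* Let $n\ge 1$. The full transformation semigroup $\mathcal{T}_n$ on an $n$-element set has a closed inverse cover if and only if $n\le 3$.
   Context: An inverse semigroup is a semigroup in which every element $a$ has a unique inverse, i.e. a unique $b$ with $aba=a$, $bab=b$. By convention the empty set is also considered to be an inverse (sub)semigroup. An inverse cover of a semigroup $S$ is a family $\mathcal{A}$ of subsemigroups of $S$, each of which is an inverse semigroup, whose union is $S$. It is a closed inverse cover if the intersection of any two members of $\mathcal{A}$ is again an inverse semigroup (possibly empty). *)

(* Defs.v *)
From HB Require Import structures.
From mathcomp Require Import all_boot.
From mathcomp Require Import boolp classical_sets.

Set Implicit Arguments.
Unset Strict Implicit.
Unset Printing Implicit Defensive.

Local Open Scope classical_set_scope.

Section InverseCovers.
Variable S : semigroupType.
Local Open Scope group_scope.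

Definition subsemigroup (A : set S) : Prop :=
  forall x y : S, A x -> A y -> A (x * y).

Definition inverse_of (a b : S) : Prop := a * b * a = a /\ b * a * b = b.

(* Inverses are sought, and required to be unique, inside A, not in S.
   The empty set satisfies this predicate. *)
Definition inverse_subsemigroup (A : set S) : Prop :=
  subsemigroup A /\ forall a : S, A a -> exists! b : S, A b /\ inverse_of a b.

Definition inverse_cover (F : set (set S)) : Prop :=
  (forall A : set S, F A -> inverse_subsemigroup A) /\
  \bigcup_(A in F) A = [set: S].

Definition closed_inverse_cover (F : set (set S)) : Prop :=
  inverse_cover F /\
  forall A B : set S, F A -> F B -> inverse_subsemigroup (A `&` B).

End InverseCovers.

(* An alias, so that the product below does not interfere with other
   structures on {ffun 'I_n -> 'I_n}. *)
Definition full_transf (n : nat) : Type := {ffun 'I_n -> 'I_n}.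

HB.instance Definition _ (n : nat) := Finite.on (full_transf n).

Section FullTransformationSemigroup.
Variable n : nat.

(* Transformations act on the right: f * g applies f first. *)
Definition transf_mul (f g : full_transf n) : full_transf n :=
  [ffun i => (g : {ffun 'I_n -> 'I_n}) ((f : {ffun 'I_n -> 'I_n}) i)].

Lemma transf_mulA : associative transf_mul.
Proof. by move=> f g h; apply/ffunP => i; rewrite !ffunE. Qed.

HB.instance Definition _ := isSemigroup.Build (full_transf n) transf_mulA.

End FullTransformationSemigroup.

(* Main.v *)
(* For n <= 3 the maximal subgroups together with three five-element Brandt
   semigroups (when n = 3) form a closed inverse cover.

   In a closed inverse cover every a has the same inverse a' in all members
   containing it, and a'' = a. Let n >= 4, fix a point o and a set K of three
   other points, and let f_p, for p in K, send K \ {p} to p and p, o to o,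
   fixing everything else. Since f_p^2 is an idempotent z absorbing f_p, it also
   absorbs f_p' and f_p'^2 = z; this leaves only two candidates for f_p' for
   each a in K \ {p}: f_a, or the map sending only p to a. The same analysis
   for the latter map yields that p |-> a is a fixed-point-free involution of
   the three-element set K, which is absurd. *)
Require Import Defs.
From mathcomp Require Import all_boot.
From mathcomp Require Import boolp classical_sets.

Set Implicit Arguments.
Unset Strict Implicit.
Unset Printing Implicit Defensive.

(** * Idempotents and inverses in an inverse subsemigroup *)

Section InverseSemigroups.
Variable S : semigroupType.
Local Open Scope group_scope.
Implicit Types (A : set S) (a b x y z e f : S).

Lemma inverse_of_sym a b : inverse_of a b -> inverse_of b a.
Proof. by case. Qed.

Lemma inverse_of_idem e : e * e = e -> inverse_of e e.
Proof. by move=> ee; split; rewrite !ee. Qed.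

Lemma inverse_of_unique A a b c : inverse_subsemigroup A -> A a -> A b -> A c ->
  inverse_of a b -> inverse_of a c -> b = c.
Proof.
move=> [_ Ainv] Aa Ab Ac ab ac; have [d [_ dU]] := Ainv a Aa.
by rewrite -(dU b) // -(dU c).
Qed.

Lemma idem_inverse A e x : inverse_subsemigroup A -> A e -> A x ->
  e * e = e -> inverse_of e x -> x = e.
Proof.
move=> Ainv Ae Ax ee ex.
exact: (inverse_of_unique Ainv Ae Ax Ae ex (inverse_of_idem ee)).
Qed.

(* If x inverts e * f then so does the idempotent f * x * e, so x is idempotent
   and therefore equal to its own inverse e * f. *)
Lemma idemM A e f : inverse_subsemigroup A -> A e -> A f ->
  e * e = e -> f * f = f -> (e * f) * (e * f) = e * f.
Proof.
move=> Ainv Ae Af ee ff; have Asub := Ainv.1.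
have [x [[Ax [efx xef]] _]] := Ainv.2 _ (Asub _ _ Ae Af).
have efxE : e * f * x * e * f = e * f by rewrite -[RHS]efx !mulgA.
have xefE : x * e * f * x = x by rewrite -[RHS]xef !mulgA.
have yy : (f * x * e) * (f * x * e) = f * x * e.
  by rewrite -[in RHS]xefE !mulgA.
have Ay : A (f * x * e) by apply: (Asub) => //; apply: (Asub).
have Aef : A (e * f) by apply: (Asub).
have efy : inverse_of (e * f) (f * x * e).
  split; first by rewrite !mulgA -(mulgA e f f) ff -(mulgA _ e e) ee.
  by rewrite !mulgA -(mulgA _ e e) ee -(mulgA _ f f) ff -[in RHS]xefE !mulgA.
by rewrite (idem_inverse Ainv Ay Aef yy (inverse_of_sym efy)).
Qed.

(** By [idemM] both products are idempotent, and each inverts the other; an idempotent has no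
    inverse but itself. *)
Lemma idemC A e f : inverse_subsemigroup A -> A e -> A f ->
  e * e = e -> f * f = f -> e * f = f * e.
Proof.
move=> Ainv Ae Af ee ff; have Asub := Ainv.1.
have efef := idemM Ainv Ae Af ee ff; have fefe := idemM Ainv Af Ae ff ee.
apply/esym/(idem_inverse Ainv (Asub _ _ Ae Af) (Asub _ _ Af Ae) efef).
split.
  by rewrite !mulgA -(mulgA e f f) ff -(mulgA _ e e) ee -[RHS]efef !mulgA.
by rewrite !mulgA -(mulgA f e e) ee -(mulgA _ f f) ff -[RHS]fefe !mulgA.
Qed.

(** * Inverses of an element whose square is an idempotent absorbing it *)

Section SquareZero.
Variables (A : set S) (a b z : S).
Hypotheses (Ainv : inverse_subsemigroup A) (Aa : A a) (Ab : A b).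
Hypotheses (ab : inverse_of a b) (aa : a * a = z) (az : a * z = z).

Let Asub : subsemigroup A. Proof. exact: Ainv.1. Qed.
Let Az : A z. Proof. by rewrite -aa; apply: Asub. Qed.
Let Aab : A (a * b). Proof. exact: Asub. Qed.
Let Aba : A (b * a). Proof. exact: Asub. Qed.
Let za : z * a = z. Proof. by rewrite -aa -mulgA aa az. Qed.
Let zz : z * z = z. Proof. by rewrite -{1}aa -mulgA !az. Qed.
Let ab_idem : (a * b) * (a * b) = a * b. Proof. by rewrite mulgA ab.1. Qed.
Let ba_idem : (b * a) * (b * a) = b * a. Proof. by rewrite mulgA ab.2. Qed.

Let zbz : z * b * z = z.
Proof.
(* Writing the left [z] as [z * a] exposes the idempotent [a * b], which commutes with [z]. *)
rewrite -{1}za -(mulgA z a b) (idemC Ainv Az Aab zz ab_idem) -mulgA zz.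
by rewrite -{1}aa mulgA ab.1 aa.
Qed.

Lemma square_zero_mull : z * b = z.
Proof.
apply: (idem_inverse Ainv Az _ zz); first exact: Asub.
by split; [rewrite mulgA zz zbz | rewrite zbz mulgA zz].
Qed.

Lemma square_zero_mulr : b * z = z.
Proof.
apply: (idem_inverse Ainv Az _ zz); first exact: Asub.
split; first by rewrite mulgA zbz zz.
by rewrite -(mulgA b) zz -mulgA (mulgA z b) zbz.
Qed.

(** The element [b * b] inverts [z = a * a], because the idempotents [b * a] and [a * b] commute in
    the middle of [b * b * a * a * b * b]. *)
Lemma square_zero_sqr : b * b = z.
Proof.
apply: (idem_inverse Ainv Az _ zz); first exact: Asub.
split; first by rewrite mulgA !square_zero_mull zz.
have -> : b * b * z * (b * b) = b * ((b * a) * (a * b)) * b.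
  by rewrite -aa !mulgA.
rewrite (idemC Ainv Aba Aab ba_idem ab_idem) !mulgA ab.2.
by rewrite -!mulgA (mulgA b a b) ab.2.
Qed.

End SquareZero.

(** * Inverses taken across a closed cover *)

Section PairedElements.
Variable F : set (set S).
Hypothesis clF : closed_inverse_cover F.

Definition paired a b :=
  exists2 A : set S, F A & [/\ A a, A b & inverse_of a b].

Lemma paired_sym a b : paired a b -> paired b a.
Proof. by case=> A FA [Aa Ab /inverse_of_sym ba]; exists A. Qed.

Lemma paired_total a : exists b, paired a b.
Proof.
have [[Finv Fcov] _] := clF.
have : (\bigcup_(A in F) A)%classic a by rewrite Fcov.
case=> A FA Aa; have [b [[Ab ab] _]] := (Finv A FA).2 a Aa.
by exists b, A.
Qed.

(** The intersection of the two members contains an inverse [d] of [a]; uniqueness in each member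
    identifies [d] with [b] and with [c]. *)
Lemma paired_inj a b c : paired a b -> paired a c -> b = c.
Proof.
have [[Finv _] FI] := clF.
move=> [A FA [Aa Ab ab]] [B FB [Ba Bc ac]].
have [d [[[Ad Bd] ad] _]] := (FI A B FA FB).2 a (conj Aa Ba).
rewrite (inverse_of_unique (Finv A FA) Aa Ab Ad ab ad).
exact: (inverse_of_unique (Finv B FB) Ba Bd Bc ad ac).
Qed.

End PairedElements.

End InverseSemigroups.

Definition tapp n (f : full_transf n) (i : 'I_n) : 'I_n :=
  (f : {ffun 'I_n -> 'I_n}) i.
Coercion tapp : full_transf >-> Funclass.

Section Transformations.
Variable n : nat.
Implicit Types (f g : full_transf n) (i : 'I_n).

Lemma tappM f g i : tapp (f * g)%g i = g (f i).
Proof. by rewrite /tapp /= /transf_mul ffunE. Qed.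

Lemma transfP f g : (forall i, f i = g i) <-> f = g.
Proof. by split=> [fg|-> //]; apply/ffunP. Qed.

End Transformations.

(** * Four points exclude a closed inverse cover *)

Section NoClosedCover.
Variables (n : nat) (K : {set 'I_n}) (o : 'I_n).
Hypotheses (K3 : #|K| = 3) (oK : o \notin K).
Implicit Types (B C : {set 'I_n}) (x p a : 'I_n) (f g : full_transf n).
Local Open Scope set_scope.

(** One family for both kinds of maps: [collapse (K :\ p) p] is f_p, and [collapse [set p] a] moves
    only [p] to [a] and the rest of [K] to the sink [o]. *)
Definition collapse B p : full_transf n :=
  [ffun x => if x \in B then p else if x \in K then o else x].

Lemma collapseE B p x :
  collapse B p x = if x \in B then p else if x \in K then o else x.
Proof. by rewrite /tapp /= ffunE. Qed.

Lemma collapse_o B p : B \subset K -> collapse B p o = o.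
Proof.
move=> /fintype.subsetP BK; rewrite collapseE (negPf oK).
by case: ifP => // /BK; rewrite (negPf oK).
Qed.

Lemma neq_oK p : p \in K -> (p == o) = false.
Proof. by move=> pK; apply: contraNF oK => /eqP <-. Qed.

Lemma collapse_inj B C p : B \subset K -> C \subset K -> p \in K ->
  collapse B p = collapse C p -> B = C.
Proof.
have mem (D : {set 'I_n}) x : D \subset K -> p \in K -> x \in K ->
    (collapse D p x == p) = (x \in D).
  move=> DK pK xK; rewrite collapseE xK; case: ifP => _; first exact: eqxx.
  by rewrite eq_sym neq_oK.
move=> BK CK pK BC; apply/setP=> x.
have [xK|xK] := boolP (x \in K); first by rewrite -(mem B) // BC mem.
have notin (D : {set 'I_n}) : D \subset K -> (x \in D) = false.
  by move=> /fintype.subsetP DK; apply: contraNF xK; apply: DK.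
by rewrite !notin.
Qed.

(** The square [z] of the collapse sends [K] to [o] and fixes all else. The square-zero lemmas then
    make [g] fix every point outside [K], while [g * f * g = g] leaves only the values [g p] and [o]
    on [K]. So [a] is [g p] and [C] is its fibre in [K]. *)
Lemma collapse_partner F B p g : closed_inverse_cover F ->
  B \subset K -> p \in K -> p \notin B -> B != finset.set0 ->
  paired F (collapse B p) g ->
  exists a C, [/\ a \in B, C \subset K, p \in C, a \notin C & g = collapse C a].
Proof.
move=> [[Finv _] _] BK pK pB Bn0 [A FA [Af Ag fg]].
set f := collapse B p in Af fg *.
pose z : full_transf n := (f * f)%g.
have zE x : z x = if (x \in K) || (x == o) then o else x.
  rewrite tappM {2}/f collapseE.
  case: ifP => [/(fintype.subsetP BK) xK|xB].
    by rewrite xK /f collapseE (negPf pB) pK.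
  case: ifP => xK; first by rewrite /f collapse_o.
  by rewrite /f collapseE xB xK /=; case: eqP.
have fo : f o = o by apply: collapse_o.
have fz : (f * z)%g = z.
  apply/transfP => x; rewrite tappM /f collapseE.
  case: ifP => [/(fintype.subsetP BK) xK|xB]; first by rewrite !zE xK pK.
  by case: ifP => xK //; rewrite !zE xK eqxx orbT.
have Ainv := Finv A FA.
have /transfP zg := square_zero_mull Ainv Af Ag fg erefl fz.
have /transfP gz := square_zero_mulr Ainv Af Ag fg erefl fz.
have /transfP gg := square_zero_sqr Ainv Af Ag fg erefl fz.
case: fg => /transfP fgf /transfP gfg.
have go : g o = o by have := zg o; rewrite tappM zE eqxx orbT.
have g_out x : x \notin K -> g x = x.
  have [-> _|xo xK] := eqVneq x o; first exact: go.
  by have := zg x; rewrite tappM zE (negPf xK) (negPf xo).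
have [b bB] := set0Pn _ Bn0.
(* Evaluating [f * g * f = f] at [b] gives [f (g p) = p], and only points of [B] are sent to [p],
   which itself lies in [K] outside [B]. *)
have gpB : g p \in B.
  have := fgf b; rewrite !tappM (_ : f b = p) ?collapseE ?bB //.
  case: ifP => // _; case: ifP => [_ op|gpK gpp].
    by move: oK; rewrite op pK.
  by rewrite gpp pK in gpK.
have gpo : (g p == o) = false by apply/neq_oK/(fintype.subsetP BK).
have ggp : g (g p) = o by rewrite -tappM gg zE pK.
have g_in x : x \in K -> g x = g p \/ g x = o.
  move=> xK; have := gfg x; rewrite !tappM {1}/f collapseE.
  case: ifP => _; first by left.
  case: ifP => gxK; first by rewrite go; right.
  by have := gz x; rewrite tappM !zE xK gxK /=; case: eqP => //; right.
exists (g p), [set x in K | g x == g p]; split=> //.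
- by apply/fintype.subsetP=> x; rewrite inE => /andP[].
- by rewrite inE pK eqxx.
- by rewrite inE ggp eq_sym gpo andbF.
apply/transfP=> x; rewrite collapseE inE.
case: ifPn => [/andP[_ /eqP] //|]; case: ifPn => [xK|/g_out //] /= /eqP.
by case: (g_in x xK).
Qed.

(** Here [a] is the image of [p] under the inverse of f_p. That inverse collapses a set [C] to [a],
    with [p] in [C] and [a] outside; since [K] has three points, [C] is [[set p]] or [K :\ a]. *)
Lemma partner_swap F p : closed_inverse_cover F -> p \in K ->
  exists a, [/\ a \in K, a != p,
    (forall g, paired F (collapse (K :\ p) p) g -> g p = a) &
    (forall g, paired F (collapse (K :\ a) a) g -> g a = p)].
Proof.
move=> clF pK.
have cardKD x : x \in K -> #|K :\ x| = 2.
  by move=> xK; have := cardsD1 x K; rewrite K3 xK => -[].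
have KDn0 x : x \in K -> K :\ x != finset.set0.
  by move=> xK; rewrite -card_gt0 cardKD.
have nKD x : x \notin K :\ x by rewrite !inE eqxx.
have [f pf] := paired_total clF (collapse (K :\ p) p).
have [a [C [aKp CK pC aC fE]]] :=
  collapse_partner clF (subsetDl _ _) pK (nKD p) (KDn0 p pK) pf.
have aK : a \in K by move: aKp; rewrite !inE => /andP[].
have ap : a != p by move: aKp; rewrite !inE => /andP[].
exists a; split=> //.
  by move=> g pg; rewrite -(paired_inj clF pf pg) fE collapseE pC.
have dichotomy (D : {set 'I_n}) x y :
    D \subset K -> x \in K -> y \in D -> x \notin D -> D = [set y] \/ D = K :\ x.
  move=> DK xK yD xD.
  have DKx : D \subset K :\ x by rewrite finset.subsetD1 DK xD.
  have := subset_leq_card DKx; rewrite cardKD // => D2.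
  have [D1|] := leqP #|D| 1.
    by left; apply/esym/eqP; rewrite eqEcard finset.sub1set yD cards1.
  by right; apply/eqP; rewrite eqEcard DKx cardKD.
have a1 : [set a] \subset K by rewrite finset.sub1set.
(* Both candidates for the inverse of f_a send [a] to [p]. *)
suff pap : paired F (collapse (K :\ a) a) (collapse [set a] p) \/
           paired F (collapse (K :\ a) a) (collapse (K :\ p) p).
  move=> g pg; case: pap => /(paired_inj clF pg) ->.
    by rewrite collapseE finset.set11.
  by rewrite collapseE aKp.
have [Cp|CKa] := dichotomy C a p CK aK pC aC; last first.
  by right; apply: paired_sym; rewrite -CKa -fE.
(* Now [f] moves only [p] to [a]. The inverse of the map moving only [a] to [p] is either [f] or
   f_a; it cannot be [f], whose inverse f_p collapses two points rather than one. *)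
left; have [g' pg'] := paired_total clF (collapse [set a] p).
have pa1 : p \notin [set a] by rewrite inE eq_sym.
have a1n0 : [set a] != finset.set0 by apply/set0Pn; exists a; rewrite inE.
have [b [D [ba DK pD]]] := collapse_partner clF a1 pK pa1 a1n0 pg'.
move: ba; rewrite inE => /eqP -> aD g'E.
have [Dp|DKa] := dichotomy D a p DK aK pD aD; last first.
  by rewrite -DKa -g'E; apply: paired_sym.
have gf : g' = f by rewrite g'E fE Cp Dp.
rewrite gf in pg'.
have /collapse_inj := paired_inj clF (paired_sym pf) (paired_sym pg').
move=> /(_ (subsetDl _ _) a1 pK) /(congr1 (fun E : {set 'I_n} => #|E|)).
by rewrite cards1 cardKD.
Qed.

Lemma no_closed_inverse_cover F : ~ closed_inverse_cover (S := full_transf n) F.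
Proof.
move=> clF.
have swap_inj p a b :
    (forall g, paired F (collapse (K :\ p) p) g -> g p = a) ->
    (forall g, paired F (collapse (K :\ p) p) g -> g p = b) -> a = b.
  have [f pf] := paired_total clF (collapse (K :\ p) p).
  by move=> /(_ f pf) <- /(_ f pf).
have [p pK] : exists p, p \in K by apply/card_gt0P; rewrite K3.
have [a [aK ap pa ap']] := partner_swap clF pK.
(* With [p] and [a] swapped, the third point [c] has a partner [d] that can be neither [p], [a] nor
   [c]: a fourth point of [K]. *)
have [c] : exists c, c \in K :\ p :\ a.
  apply/card_gt0P; have := cardsD1 p K; have := cardsD1 a (K :\ p).
  by rewrite K3 pK !inE ap aK => -> [->].
rewrite !inE => /and3P[ca cp cK].
have [d [dK dc cd dc']] := partner_swap clF cK.
have dp : d != p.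
  by apply: contra ca => /eqP dp; rewrite dp in dc'; rewrite (swap_inj _ _ _ pa dc').
have da : d != a.
  by apply: contra cp => /eqP da; rewrite da in dc'; rewrite (swap_inj _ _ _ ap' dc').
have : [set p; a; c; d] \subset K.
  by apply/fintype.subsetP=> x; rewrite !inE -!orbA => /or4P[] /eqP->.
move/subset_leq_card; rewrite K3 -!finset.setUA !cardsU1 cards1 !inE !negb_or.
by rewrite 3!(eq_sym p) ap cp dp 2!(eq_sym a) ca da (eq_sym c) dc.
Qed.

End NoClosedCover.

(** * Closed covers for small n, by computation on lists of values *)

Section Words.

(** The left factor acts first, as in [transf_mul]. The default [0] is never reached on words in
    [words n n], whose entries are below their length. *)
Definition wmul (s t : seq nat) : seq nat := [seq nth 0 t i | i <- s].

Definition winverse (s t : seq nat) : bool :=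
  (wmul (wmul s t) s == s) && (wmul (wmul t s) t == t).

Definition winverse_semigroup (L : seq (seq nat)) : bool :=
  all (fun s => all (fun t => wmul s t \in L) L) L &&
  all (fun s => count (winverse s) L == 1) L.

Fixpoint words n k : seq (seq nat) :=
  if k is k'.+1 then [seq i :: w | i <- iota 0 n, w <- words n k'] else [:: [::]].

(** The case [L = M] of the second test says that each list is itself an inverse semigroup. *)
Definition wclosed_cover n (fam : seq (seq (seq nat))) : bool :=
  [&& all (all [in words n n]) fam,
      all (fun L => all (fun M : seq (seq nat) =>
        winverse_semigroup [seq w <- L | w \in M]) fam) fam
    & all (fun w => has (fun L => w \in L) fam) (words n n)].

Lemma mem_words n k w :
  (w \in words n k) = (size w == k) && all (fun i => i < n) w.
Proof.
elim: k w => [|k IHk] [|i w] //=; first by apply/allpairsP => -[[? ?] [_ _]].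
rewrite eqSS andbCA -IHk.
apply/allpairsP/andP => [[[j v] /= [jn vw [-> ->]]]|[ni wk]].
  by split=> //; rewrite mem_iota in jn.
by exists (i, w); split; rewrite // mem_iota.
Qed.

Variable n : nat.
Implicit Types f g : full_transf n.

Definition word f : seq nat := [seq val (f i) | i <- enum 'I_n].

Lemma nth_word f (i : 'I_n) : nth 0 (word f) i = f i.
Proof. by rewrite (nth_map i) ?size_enum_ord // nth_ord_enum. Qed.

Lemma word_inj : injective word.
Proof.
move=> f g fg; apply/transfP => i; apply/val_inj.
by rewrite /= -!nth_word fg.
Qed.

Lemma wordM f g : word (f * g)%g = wmul (word f) (word g).
Proof.
rewrite /wmul -map_comp; apply: eq_map => i /=.
by rewrite nth_word -tappM.
Qed.

Lemma word_words f : word f \in words n n.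
Proof.
rewrite mem_words size_map size_enum_ord eqxx /=.
by apply/allP=> _ /mapP[i _ ->]; apply: ltn_ord.
Qed.

Lemma words_word w : w \in words n n -> exists f, word f = w.
Proof.
rewrite mem_words => /andP[/eqP sw /allP wn].
have wi (i : 'I_n) : nth 0 w i < n by apply/wn/mem_nth; rewrite sw.
exists [ffun i => Ordinal (wi i)]; apply: (@eq_from_nth _ 0).
  by rewrite size_map size_enum_ord.
move=> i; rewrite size_map size_enum_ord => lti.
by rewrite (nth_word _ (Ordinal lti)) /tapp ffunE.
Qed.

Lemma winverseP f g : winverse (word f) (word g) <-> inverse_of f g.
Proof.
rewrite /winverse -!wordM; split=> [|[-> ->]]; last by rewrite !eqxx.
by move=> /andP[/eqP/word_inj fgf /eqP/word_inj].
Qed.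

Lemma winverse_semigroupP (L : seq (seq nat)) :
  {subset L <= words n n} -> winverse_semigroup L ->
  inverse_subsemigroup [set f | word f \in L]%classic.
Proof.
move=> Lw /andP[/allP Lmul /allP Linv]; split=> [f g /= fL gL|f /= fL].
  by rewrite wordM; apply: (allP (Lmul _ fL)).
have /eqP cnt := Linv _ fL.
have /hasP[w wL fw] : has (winverse (word f)) L by rewrite has_count cnt.
have [g gw] := words_word (Lw _ wL); rewrite -gw in wL fw.
exists g; split=> [|h [/= hL fh]]; first by split=> //; apply/winverseP.
move/winverseP: fh => fh; apply: word_inj.
(* The list of inverses of [word f] has length one and contains both [word g] and [word h]. *)
move: cnt; rewrite -size_filter.
have : word g \in [seq w <- L | winverse (word f) w] by rewrite mem_filter fw.
have : word h \in [seq w <- L | winverse (word f) w] by rewrite mem_filter fh.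
case: (filter _ _) => [|v [|]] //; by rewrite !inE => /eqP-> /eqP->.
Qed.

Lemma wclosed_coverP fam : wclosed_cover n fam ->
  exists F : set (set (full_transf n)), closed_inverse_cover F.
Proof.
move=> /and3P[/allP famw /allP famI /allP famU].
pose U (L : seq (seq nat)) : set (full_transf n) := [set f | word f \in L]%classic.
have UI L M : L \in fam -> M \in fam -> inverse_subsemigroup (U L `&` U M)%classic.
  move=> Lf Mf; have -> : (U L `&` U M)%classic = U [seq w <- L | w \in M].
    by apply/seteqP; split=> f; rewrite /U /= mem_filter andbC => /andP.
  apply: winverse_semigroupP; last exact: (allP (famI _ Lf)).
  by move=> w; rewrite mem_filter => /andP[_]; apply: (allP (famw _ Lf)).
exists [set A | exists2 L, L \in fam & A = U L]%classic; split; last first.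
  by move=> _ _ [L Lf ->] [M Mf ->]; apply: UI.
split=> [_ [L Lf ->]|]; first by rewrite -[U L]classical_sets.setIid; apply: UI.
apply/seteqP; split=> // f _; have /hasP[L Lf fL] := famU _ (word_words f).
by exists (U L) => //; exists L.
Qed.

End Words.

(* For n = 3: the maximal subgroups, and for each point c the Brandt semigroup
   of the partial injections of rank at most 1 on the other two points, with c
   playing the role of "undefined". *)
Definition small_family n : seq (seq (seq nat)) :=
  match n with
  | 1 => [:: [:: [:: 0]]]
  | 2 => [:: [:: [:: 0; 1]; [:: 1; 0]]; [:: [:: 0; 0]]; [:: [:: 1; 1]]]
  | 3 => [::
      [:: [:: 0; 1; 2]; [:: 0; 2; 1]; [:: 1; 0; 2]; [:: 1; 2; 0]; [:: 2; 0; 1];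
          [:: 2; 1; 0]];
      [:: [:: 0; 0; 2]; [:: 2; 2; 0]]; [:: [:: 1; 1; 2]; [:: 2; 2; 1]];
      [:: [:: 0; 1; 0]; [:: 1; 0; 1]]; [:: [:: 2; 1; 2]; [:: 1; 2; 1]];
      [:: [:: 0; 1; 1]; [:: 1; 0; 0]]; [:: [:: 0; 2; 2]; [:: 2; 0; 0]];
      [:: [:: 0; 0; 0]; [:: 0; 1; 0]; [:: 0; 0; 2]; [:: 0; 2; 0]; [:: 0; 0; 1]];
      [:: [:: 1; 1; 1]; [:: 0; 1; 1]; [:: 1; 1; 2]; [:: 2; 1; 1]; [:: 1; 1; 0]];
      [:: [:: 2; 2; 2]; [:: 0; 2; 2]; [:: 2; 1; 2]; [:: 1; 2; 2]; [:: 2; 0; 2]]]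
  | _ => [::]
  end.

Lemma small_closed_cover n : 0 < n <= 3 -> wclosed_cover n (small_family n).
Proof. by case: n => [|[|[|[|n]]]] // _; vm_compute. Qed.

Theorem theorem4p2p3 (n : nat) (hn : 1 <= n) :
  (exists F : set (set (full_transf n)), closed_inverse_cover F) <-> n <= 3.
Proof.
split=> [[F clF]|n3]; last first.
  by apply/wclosed_coverP/small_closed_cover; rewrite hn.
case: n {hn} F clF => [|[|[|[|n]]]] // F clF; exfalso.
(* The point 0 serves as [o], and 1, 2, 3 form [K]; [inord] gives the intended points since there
   are at least four. *)
pose k i : 'I_n.+4 := inord i.
have kE i : i < 4 -> k i = i :> nat.
  by move=> i4; rewrite inordK // (leq_trans i4).
apply: (no_closed_inverse_cover (K := [set k 1; k 2; k 3]%SET) (o := ord0)) clF.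
  by rewrite -finset.setUA !cardsU1 cards1 !inE -!val_eqE /= !kE.
by rewrite !inE -!val_eqE /= !kE.
Qed.
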